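(* Let $G$ be a finite $2$-edge-coloured graph and let $k \geq 1$ be an integer. Then the following hold: (i) $G \to D_{2k}$ if and only if $F_{2k} \not\to G$; (ii) $G \to D^B_{2k-1}$ if and only if $F^R_{2k-1} \not\to G$; (iii) $G \to D^R_{2k-1}$ if and only if $F^B_{2k-1} \not\to G$.
   Context: A $2$-edge-coloured graph $G$ is a vertex set $V(G)$ together with two sets $E_1(G), E_2(G)$ of undirected edges; colour 1 is called blue and colour 2 is called red. Loops are allowed, and parallel edges (and parallel loops) are allowed provided they have different colours. A homomorphism $\varphi : G \to H$ of $2$-edge-coloured graphs is a map $\varphi : V(G) \to V(H)$ such that $uv \in E_i(G)$ implies $\varphi(u)\varphi(v) \in E_i(H)$ for $i = 1,2$. We write $G \to H$ if a homomorphism exists and $G \not\to H$ otherwise. Alternating paths. For $k \geq 1$, $F^B_k$ and $F^R_k$ are paths of length $k$ (that is, with $k$ edges) on distinct vertices $v_0, v_1, \dots, v_k$ with edges $v_{t}v_{t+1}$, whose edges successively alternate in colour between blue and red. When $k$ is odd, the middle edge $v_{\lfloor k/2\rfloor}v_{\lceil k/2\rceil}$ is blue in $F^B_k$ and red in $F^R_k$. When $k$ is even, the two alternating paths of length $k$ are isomorphic, and $F_k = F_k^B = F_k^R$ denotes either. Targets. For $k \geq 1$ let $j = \lfloor k/2 \rfloor$. The $2$-edge-coloured graph $D_k$ has vertex set $\{\pm 1, \pm 2, \dots, \pm j\}$ if $k$ is even and $\{0, \pm 1, \pm 2, \dots, \pm j\}$ if $k$ is odd. There are blue loops on $1, 2,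 \dots, j$, red loops on $-1, -2, \dots, -j$, and exactly one edge $rs$ for each pair of vertices with $|r| < |s|$; this edge is blue if $r > 0$ and red if $r < 0$, and if $r = 0$ it is blue if $s > 0$ and red if $s < 0$. There are no other edges or loops. For odd $k$, $D^B_k$ (respectively $D^R_k$) is obtained from $D_k$ by adding a blue loop (respectively a red loop) at the vertex $0$. *)

(* Defs.v *)
From mathcomp Require Import all_boot all_order all_algebra.

Set Implicit Arguments.
Unset Strict Implicit.
Unset Printing Implicit Defensive.

Import Order.TTheory GRing.Theory Num.Theory.

(* The colours are booleans, so that [~~ c] is the other colour. *)
Definition colour := bool.
Definition blue : colour := true.
Definition red : colour := false.

(* Loops are the reflexive pairs of [edge c]. Since [edge c] is a relation,  *)
(* parallel edges and parallel loops necessarily have different colours.     *)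
Record ecgraph := ECGraph {
  vertex : finType;
  edge : colour -> rel vertex;
  edge_sym : forall c, symmetric (edge c)
}.

Definition is_hom (G H : ecgraph) (f : vertex G -> vertex H) : Prop :=
  forall (c : colour) (u v : vertex G), edge c u v -> edge c (f u) (f v).

Definition maps_to (G H : ecgraph) : Prop :=
  exists f : vertex G -> vertex H, is_hom f.

Definition isomorphic (G H : ecgraph) : Prop :=
  exists2 f : vertex G -> vertex H, bijective f &
    forall (c : colour) (u v : vertex G), edge c (f u) (f v) = edge c u v.

(* In the alternating path of length k whose edge v_t v_(t+1) with t = k./2   *)
(* has colour c, [path_colour k c t] is the colour of the edge v_t v_(t+1).  *)
(* For odd k the edge of index k./2 is the middle one.                       *)
Definition path_colour (k : nat) (c : colour) (t : nat) : colour :=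
  if odd (t + k./2) then ~~ c else c.

Definition path_edge (k : nat) (c d : colour) : rel 'I_k.+1 :=
  fun u v => ((v == u.+1 :> nat) && (path_colour k c u == d))
          || ((u == v.+1 :> nat) && (path_colour k c v == d)).

Lemma path_edge_sym (k : nat) (c d : colour) : symmetric (@path_edge k c d).
Proof. by move=> u v; rewrite /path_edge orbC. Qed.

Definition alt_path (k : nat) (c : colour) : ecgraph :=
  ECGraph (@path_edge_sym k c).

Definition F_B (k : nat) : ecgraph := alt_path k blue.
Definition F_R (k : nat) : ecgraph := alt_path k red.

(* For even k there is no middle edge; F_B and F_R are then isomorphic (see  *)
(* [F_B_F_R_iso] below), and F may denote either. F is only used for even k. *)
Definition F (k : nat) : ecgraph := F_B k.

Lemma F_B_F_R_iso (k : nat) : ~~ odd k -> isomorphic (F_B k) (F_R k).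
Proof.
move=> ek; exists (@rev_ord k.+1); first exact: (inv_bij rev_ordK).
have col c t : t < k -> path_colour k (~~ c) (k - t.+1) = path_colour k c t.
  move=> tk; rewrite /path_colour !oddD oddB //= (negbTE ek).
  by case: c (odd t) (odd k./2) => [] [] [].
have eqrev (u v : 'I_k.+1) : (k - v == (k - u).+1) = (u == v.+1 :> nat).
  have := ltn_ord u; have := ltn_ord v; rewrite !ltnS => vk uk.
  have -> : (k - u).+1 = k.+1 - u by rewrite subSn.
  apply/eqP/eqP => [E|->]; last by rewrite subSS.
  apply/eqP; rewrite -(eqn_add2r (k - v)) {1}E subnKC ?leqW //.
  by rewrite addSn subnKC.
have half (d : colour) (u v : 'I_k.+1) :
    (k - v == (k - u).+1) && (path_colour k red (k - u) == d)
    = (u == v.+1 :> nat) && (path_colour k blue v == d).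
  rewrite eqrev; case: eqP => //= uv; congr (_ == _).
  by rewrite uv -(col blue) // -ltnS -uv ltn_ord.
move=> d u v; rewrite /= /path_edge /= !subSS !half.
by rewrite orbC.
Qed.

Local Open Scope ring_scope.

Definition D_vertices (k : nat) : seq int :=
  (if odd k then [:: 0] else [::])
  ++ [seq i%:Z | i <- iota 1 k./2] ++ [seq - i%:Z | i <- iota 1 k./2].

Definition has_sign (c : colour) (r : int) : bool :=
  if c == blue then 0 < r else r < 0.

Definition D_edge_lt (c : colour) (r s : int) : bool :=
  (`|r| < `|s|) && (if r == 0 then has_sign c s else has_sign c r).

Definition D_edge (c : colour) (r s : int) : bool :=
  [|| (r == s) && has_sign c r, D_edge_lt c r s | D_edge_lt c s r].

Definition D_edge_loop (c0 c : colour) (r s : int) : bool :=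
  D_edge c r s || [&& c == c0, r == 0 & s == 0].

Lemma D_edge_sym (c : colour) : symmetric (D_edge c).
Proof.
move=> r s; rewrite /D_edge [D_edge_lt c r s || _]orbC [s == r]eq_sym.
by congr (_ || _); case: eqP => // ->.
Qed.

Lemma D_edge_loop_sym (c0 c : colour) : symmetric (D_edge_loop c0 c).
Proof. by move=> r s; rewrite /D_edge_loop D_edge_sym [(r == 0) && _]andbC. Qed.

Definition int_graph (V : seq int) (e : colour -> rel int)
    (e_sym : forall c, symmetric (e c)) : ecgraph :=
  @ECGraph (seq_sub V) (fun c => relpre val (e c))
    (fun c x y => e_sym c (val x) (val y)).

Definition D (k : nat) : ecgraph := int_graph (D_vertices k) D_edge_sym.

(* Only used for odd k, when 0 is a vertex. *)
Definition D_B (k : nat) : ecgraph :=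
  int_graph (D_vertices k) (D_edge_loop_sym blue).
Definition D_R (k : nat) : ecgraph :=
  int_graph (D_vertices k) (D_edge_loop_sym red).

(* Main.v *)
(* A homomorphic image of an alternating path is an alternating walk, so the  *)
(* path maps to G iff some vertex starts two alternating walks of about half  *)
(* the length with opposite first colours. In the targets, a walk from r <> 0 *)
(* whose first colour is opposite to the sign of r has length less than |r|,  *)
(* because its vertices change sign and decrease in absolute value at each    *)
(* step; this excludes such a pair of walks. Conversely, let b and r be the   *)
(* lengths, truncated at K, of the longest walks from v starting in blue and  *)
(* in red, K being half the length of the path, rounded down. Map v to r + 1  *)
(* if r <= b, to -(b + 1) if b < r, and to 0 if both are equal to K. This is  *)
(* a homomorphism, since a blue edge uv gives b(v) >= r(u) + 1 up to          *)
(* truncation, and symmetrically; the path being absent, no vertex is mapped  *)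
(* to 0 in the even case, and in the odd case all edges inside the fibre of 0 *)
(* have the colour of its loop.                                               *)
Require Import Defs.
From mathcomp Require Import all_boot all_order all_algebra.
From mathcomp Require Import zify.

Set Implicit Arguments.
Unset Strict Implicit.
Unset Printing Implicit Defensive.

Import Order.TTheory GRing.Theory Num.Theory.

(** [maps_to_alt_pathP] trades the path for two walks from one vertex. [alt_walk_lt_abs] then rules
    this pair out in the targets, and [label_edge] makes [label] the homomorphism when the pair is
    absent from [G]. Even and odd lengths differ only in the treatment of 0. *)

(* [c] is the colour of the first edge. *)
Fixpoint alt_walk (G : ecgraph) (c : colour) (n : nat) (v : vertex G) : bool :=
  if n is m.+1 then [exists u, edge c v u && alt_walk (~~ c) m u] else true.

Lemma alt_walkS (G : ecgraph) c n (v : vertex G) :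
  alt_walk c n.+1 v -> alt_walk c n v.
Proof.
elim: n c v => //= n IHn c v /existsP[u /andP[vu wu]].
by apply/existsP; exists u; rewrite vu IHn.
Qed.

Lemma alt_walk_leq (G : ecgraph) c m n (v : vertex G) :
  m <= n -> alt_walk c n v -> alt_walk c m v.
Proof.
elim: n => [|n IHn]; first by rewrite leqn0 => /eqP->.
by rewrite leq_eqVlt ltnS => /predU1P[-> //|mn /alt_walkS/(IHn mn)].
Qed.

Lemma alt_walkP (G : ecgraph) c n (v : vertex G) :
  alt_walk c n v <->
  exists2 g : nat -> vertex G, g 0 = v &
    forall t, t < n -> edge (c (+) odd t) (g t) (g t.+1).
Proof.
elim: n c v => [|n IHn] c v; first by split=> // _; exists (fun=> v).
split=> [/existsP[u /andP[vu /IHn[g g0 gE]]]|[g g0 gE]].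
  exists (fun t => if t is s.+1 then g s else v) => // -[_|t tn] /=.
    by rewrite addbF g0.
  by rewrite addbN -addNb gE.
apply/existsP; exists (g 1).
have := gE 0 isT; rewrite g0 addbF => -> /=.
apply/IHn; exists (fun t => g t.+1) => // t tn.
by rewrite addNb -addbN (gE t.+1).
Qed.

Lemma path_colourE n c t : path_colour n c t = c (+) odd (t + n./2).
Proof. by rewrite /path_colour addbC; case: odd. Qed.

(** Cut the path at its vertex of index [n./2]: the left half, read backwards, starts in [~~ c], the
    right half in [c]. *)
Lemma maps_to_alt_pathP (G : ecgraph) n c :
  maps_to (alt_path n c) G <->
  exists2 v : vertex G, alt_walk (~~ c) n./2 v & alt_walk c (n - n./2) v.
Proof.
have hn : n./2 <= n by lia.
split=> [[f fE]|[v /alt_walkP[g g0 gE] /alt_walkP[h h0 hE]]].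
  have fS t : t < n -> edge (path_colour n c t) (f (inord t)) (f (inord t.+1)).
    by move=> tn; apply: fE; rewrite /= /path_edge !inordK ?eqxx // ltnS ltnW.
  exists (f (inord n./2)); apply/alt_walkP.
    exists (fun t => f (inord (n./2 - t))) => [|t tn]; first by rewrite subn0.
    rewrite edge_sym; have := fS (n./2 - t.+1).
    rewrite subnSK // path_colourE oddD oddB // addNb -addbN /=.
    by rewrite addbAC addbb addFb; apply; lia.
  exists (fun t => f (inord (n./2 + t))) => [|t tn]; first by rewrite addn0.
  have := fS (n./2 + t).
  rewrite path_colourE addnS addnAC oddD addnn odd_double.
  by apply; lia.
pose f t := if t < n./2 then g (n./2 - t) else h (t - n./2).
have fS t : t < n -> edge (path_colour n c t) (f t) (f t.+1).
  move=> tn; rewrite path_colourE /f; have [tlt|tge] := ltnP t n./2.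
    have -> : (if t.+1 < n./2 then g (n./2 - t.+1) else h (t.+1 - n./2)) =
              g (n./2 - t.+1).
      (* At the junction both pieces take the common value [v]. *)
      case: ltnP => // ge; have -> : t.+1 = n./2 by lia.
      by rewrite subnn h0 g0.
    have -> : c (+) odd (t + n./2) = ~~ c (+) odd (n./2 - t.+1).
      by rewrite oddB // oddD /=; case: (c) (odd t) (odd n./2) => [] [] [].
    by rewrite edge_sym -(subnSK tlt) gE //; lia.
  rewrite ifN -?leqNgt ?leqW // subSn //.
  have := hE (t - n./2); rewrite oddB // oddD; apply; lia.
exists (fun u : 'I_n.+1 => f u) => d u w /=; rewrite /path_edge.
case/orP=> /andP[/eqP uw /eqP <-]; last rewrite edge_sym; rewrite uw; apply: fS.
  by have := ltn_ord w; rewrite uw.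
by have := ltn_ord u; rewrite uw.
Qed.

Lemma is_hom_alt_walk (G H : ecgraph) (f : vertex G -> vertex H) c n v :
  is_hom f -> alt_walk c n v -> alt_walk c n (f v).
Proof.
move=> fE; elim: n c v => //= n IHn c v /existsP[u /andP[vu wu]].
by apply/existsP; exists (f u); rewrite fE ?IHn.
Qed.

(** Walks may repeat vertices, so without the cap [K] there may be no longest one. *)
Definition longest (G : ecgraph) (K : nat) (c : colour) (v : vertex G) : nat :=
  \max_(n < K.+1 | alt_walk c n v) n.

Lemma longest_leq (G : ecgraph) K c (v : vertex G) : longest K c v <= K.
Proof. by apply/bigmax_leqP => i _; rewrite -ltnS. Qed.

Lemma leq_longest (G : ecgraph) K c n (v : vertex G) :
  n <= K -> (n <= longest K c v) = alt_walk c n v.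
Proof.
move=> nK; apply/idP/idP => [/alt_walk_leq|wn].
  apply; apply: (big_ind (fun m => alt_walk c m v)) => // m p wm wp.
  by rewrite /maxn; case: ifP.
have nK1 : n < K.+1 by [].
exact: (@leq_bigmax_cond _ _ (fun i : 'I_K.+1 => i : nat) (Ordinal nK1)).
Qed.

(** Prepend the edge from [v] to [u] to a longest walk from [u]. *)
Lemma longest_edge (G : ecgraph) K c (u v : vertex G) :
  edge c u v -> minn K (longest K (~~ c) u).+1 <= longest K c v.
Proof.
move=> uv; rewrite leq_longest ?geq_minl //.
apply: (alt_walk_leq (geq_minr _ _)); apply/existsP; exists u.
have := leq_longest (~~ c) u (longest_leq K (~~ c) u); rewrite leqnn.
by rewrite edge_sym uv => /esym.
Qed.

Local Open Scope ring_scope.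

(** A form free of conditionals, suited to [lia]. *)
Lemma D_edgeE (c : colour) (r s : int) :
  D_edge c r s = [|| (r == s) && has_sign c r,
    (`|r| < `|s|) && ((r == 0) && has_sign c s || has_sign c r)
    | (`|s| < `|r|) && ((s == 0) && has_sign c r || has_sign c s)].
Proof.
rewrite /D_edge /D_edge_lt /has_sign; case: (c == blue);
  by case: (eqVneq r 0); case: (eqVneq s 0); lia.
Qed.

Definition label (G : ecgraph) (K : nat) (v : vertex G) : int :=
  let b := longest K blue v in let r := longest K red v in
  if (K <= minn b r)%N then 0
  else if (r <= b)%N then r.+1%:Z else - b.+1%:Z.

Lemma label_eq0 (G : ecgraph) K (v : vertex G) :
  (label K v == 0) = alt_walk blue K v && alt_walk red K v.
Proof.
rewrite -!(leq_longest _ _ (leqnn K)) -leq_min /label.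
by case: ifP => // _; case: ifP => _; lia.
Qed.

Lemma label_leq (G : ecgraph) K (v : vertex G) : (`|label K v| <= K)%N.
Proof.
rewrite /label; have := longest_leq K blue v; have := longest_leq K red v.
by move=> rK bK; case: ifP => [_|]; last case: ifP; lia.
Qed.

(** The two inequalities of [longest_edge], one per direction of the edge, and the cap [K] leave
    only arithmetic. Two labels 0 carry no information on the colour, hence the exception. *)
Lemma label_edge (G : ecgraph) K c (u v : vertex G) :
  edge c u v -> [|| D_edge c (label K u) (label K v) |
                    (label K u == 0) && (label K v == 0)].
Proof.
move=> uv; have vu : edge c v u by rewrite edge_sym.
move: (longest_edge K uv) (longest_edge K vu); rewrite /label.
move: (longest_leq K blue u) (longest_leq K red u).
move: (longest_leq K blue v) (longest_leq K red v).
rewrite D_edgeE /has_sign /blue /red.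
case: c {uv vu} => /=; move: (longest _ _ u) (longest _ _ u) => ru bu.
all: move: (longest _ _ v) (longest _ _ v) => rv bv.
all: case: ifP; case: ifP; try case: ifP; try case: ifP; lia.
Qed.

Lemma mem_D_vertices n x :
  (x \in D_vertices n) = if x == 0 then odd n else (`|x| <= n./2)%N.
Proof.
rewrite /D_vertices !mem_cat.
have mpos : (x \in [seq i%:Z | i <- iota 1 n./2]) =
            (0 < x) && (`|x| <= n./2)%N.
  apply/mapP/andP => [[i]|[x0 xn]]; first by rewrite mem_iota => ? ->; lia.
  by exists `|x|%N; rewrite ?mem_iota; lia.
have mneg : (x \in [seq - i%:Z | i <- iota 1 n./2]) =
            (x < 0) && (`|x| <= n./2)%N.
  apply/mapP/andP => [[i]|[x0 xn]]; first by rewrite mem_iota => ? ->; lia.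
  by exists `|x|%N; rewrite ?mem_iota; lia.
have -> : (x \in (if odd n then [:: 0] else [::])) = odd n && (x == 0).
  by case: odd; rewrite ?inE.
by rewrite mpos mneg; case: ifP; case: odd; lia.
Qed.

Lemma maps_to_int_graph (G : ecgraph) (V : seq int) (e : colour -> rel int)
    (e_sym : forall c, symmetric (e c)) (f : vertex G -> int) :
  (forall v, f v \in V) ->
  (forall c u v, edge c u v -> e c (f u) (f v)) ->
  maps_to G (int_graph V e_sym).
Proof. by move=> fV fE; exists (fun v => SeqSub (fV v)) => c u v /fE. Qed.

(** A first edge of colour [c], opposite to the sign of [x], must reach a vertex of sign [c] closer
    to 0. Extra loops at 0 are allowed in order to cover all the targets. *)
Lemma alt_walk_lt_abs (V : seq int) (e : colour -> rel int)
    (e_sym : forall c, symmetric (e c)) c n (x : vertex (int_graph V e_sym)) :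
  (forall c r s, e c r s -> D_edge c r s || (r == 0) && (s == 0)) ->
  has_sign (~~ c) (val x) -> alt_walk c n x -> (n < `|val x|)%N.
Proof.
move=> eD; elim: n c x => [|n IHn] c x sx.
  by move: sx; rewrite /has_sign; case: ifP => _ /=; lia.
move=> /existsP[y /andP[/eD xy wy]].
suff [sy yx] : has_sign c (val y) /\ (`|val y| < `|val x|)%N.
  by apply: leq_trans yx; apply: IHn wy; rewrite negbK.
move: sx xy {wy}; rewrite D_edgeE /has_sign /blue.
by case: c => /=; move: (val x) (val y) => r s; lia.
Qed.

Lemma maps_to_D_even (G : ecgraph) k c :
  maps_to G (D k.*2) <-> ~ maps_to (alt_path k.*2 c) G.
Proof.
rewrite maps_to_alt_pathP doubleK -addnn addnK addnn.
split=> [[f fE] [v /(is_hom_alt_walk fE) w1 /(is_hom_alt_walk fE) w2]|noF].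
  have := valP (f v); rewrite mem_D_vertices odd_double doubleK.
  case: ifPn => // x0; rewrite leqNgt => /negP[].
  have edgeD (d : colour) r s :
      D_edge d r s -> D_edge d r s || (r == 0) && (s == 0).
    by move->.
  (* Whatever the sign of [f v], one of the two walks starts against it. *)
  have [sx|sx] := boolP (has_sign c (val (f v))).
    by apply: alt_walk_lt_abs w1; rewrite ?negbK.
  apply: alt_walk_lt_abs w2 => //; move: sx x0; rewrite /has_sign /blue.
  by case: c {w1}; rewrite /=; move: (val _) => x; lia.
have n0 (v : vertex G) : label k v != 0.
  rewrite label_eq0; apply/negP => /andP[wb wr]; apply: noF; exists v.
    by case: c.
  by case: c.
apply: (@maps_to_int_graph G _ _ _ (@label G k)) => [v|d u v /(label_edge k)].
  by rewrite mem_D_vertices (negPf (n0 v)) doubleK label_leq.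
by rewrite (negPf (n0 u)) orbF.
Qed.

Lemma maps_to_D_odd (G : ecgraph) k c :
  maps_to G (int_graph (D_vertices k.*2.+1) (D_edge_loop_sym c)) <->
  ~ maps_to (alt_path k.*2.+1 (~~ c)) G.
Proof.
have hk : k.*2.+1./2 = k by rewrite /= uphalf_double.
have hk' : (k.*2.+1 - k = k.+1)%N by rewrite -addnn subSn ?leq_addr ?addnK.
rewrite maps_to_alt_pathP hk hk' negbK.
split=> [[f fE] [v /(is_hom_alt_walk fE) w1 /(is_hom_alt_walk fE) w2]|noF].
  have edgeD (d : colour) r s :
      D_edge_loop c d r s -> D_edge d r s || (r == 0) && (s == 0).
    by case/orP=> [->//|/and3P[_ -> ->]]; rewrite orbT.
  have xk (y : seq_sub (D_vertices k.*2.+1)) : (`|val y| <= k)%N.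
    have := valP y; rewrite mem_D_vertices hk; case: ifP => // /eqP->.
    by rewrite absz0.
  have [sx|sx] := boolP (has_sign (~~ c) (val (f v))).
    by have := alt_walk_lt_abs edgeD sx w1; rewrite ltnNge xk.
  have [sx'|sx'] := boolP (has_sign c (val (f v))).
    have := alt_walk_lt_abs edgeD _ w2; rewrite negbK => /(_ sx').
    by rewrite ltnNge ltnW // ltnS xk.
  (* Now [f v] is 0, whose loop has colour [c]; the first edge of the longer walk has colour [~~ c],
     so it reaches some [y] of sign [~~ c], with [k] steps left. *)
  have /existsP[y /andP[xy]] := w2; rewrite negbK => wy.
  suff sy : has_sign (~~ c) (val y).
    by have := alt_walk_lt_abs edgeD sy wy; rewrite ltnNge xk.
  move: sx sx' xy; rewrite /= /D_edge_loop D_edgeE /has_sign /blue.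
  move: (val _) (val y) => r s {w1 w2 wy fE edgeD}.
  by case: (c) => /=; lia.
apply: (@maps_to_int_graph G _ _ _ (@label G k)) => [v|d u v uv].
  by rewrite mem_D_vertices hk label_leq /= odd_double if_same.
rewrite /D_edge_loop; have /orP[->//|/andP[u0 v0]] := label_edge k uv.
rewrite u0 v0 !andbT; case: eqP => [|/eqP dc]; rewrite ?orbT //.
(* An edge of colour [~~ c] between two vertices labelled 0 extends a walk of length [k] from [v] to
   one of length [k.+1] from [u], which gives the excluded path. *)
case: noF; move: u0 v0; rewrite !label_eq0 => /andP[ub ur] /andP[vb vr].
exists u; first by case: c {dc}.
have dE : d = ~~ c by case: d c dc {uv} => [] [].
by apply/existsP; exists v; rewrite -dE uv dE negbK; case: c {dc dE}.
Qed.

Local Close Scope ring_scope.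

Theorem theorem2p4 (G : ecgraph) (k : nat) (hk : 1 <= k) :
  (maps_to G (D (2 * k)) <-> ~ maps_to (F (2 * k)) G) /\
  (maps_to G (D_B (2 * k - 1)) <-> ~ maps_to (F_R (2 * k - 1)) G) /\
  (maps_to G (D_R (2 * k - 1)) <-> ~ maps_to (F_B (2 * k - 1)) G).
Proof.
case: k hk => // k _; rewrite mul2n; split; first exact: maps_to_D_even.
rewrite doubleS subn1 /=.
by split; [apply: (maps_to_D_odd G k blue) | apply: (maps_to_D_odd G k red)].
Qed.
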